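(* D-APEP$\langle\mathsf{BoD_U}\rangle$ is solvable in polynomial time.
   Context: D-APEP. An instance consists of a finite set $U$ of users, a finite set $R$ of resources, a base authorization relation $A_{\sf Bse}\subseteq U\times R$ with $A_{\sf Bse}(r)\neq\emptyset$ for all $r\in R$, and a set $C$ of constraints. For $A\subseteq U\times R$, $A(r)=\{u\in U:(u,r)\in A\}$. $A$ is authorized if $A\subseteq A_{\sf Bse}$, complete if $A(r)\ne\emptyset$ for all $r\in R$, eligible if it satisfies every $c\in C$, and valid if it is authorized, complete and eligible. The problem is to decide whether a valid $A$ exists and, if so, find one. $\mathsf{BoD_U}$ is the family of constraints $(r,r',\leftrightarrow,\forall)$ with $r,r'\in R$; such a constraint is satisfied by a complete $A$ iff $A(r)=A(r')$. D-APEP$\langle\mathsf{BoD_U}\rangle$ is the restriction to instances in which all constraints are $\mathsf{BoD_U}$ constraints. *)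

(* Defs.v *)
From mathcomp Require Import all_boot all_order all_algebra.

Set Implicit Arguments.
Unset Strict Implicit.
Unset Printing Implicit Defensive.

Inductive move := MoveLeft | Stay | MoveRight.

(* The tape alphabet consists of the input/output alphabet [S], the machine's
   own work symbols [tm_work], and the blank [None]. *)
Definition cell (S G : Type) := option (S + G).

(* Input on the first tape, output on the last one; there is at least one tape.
   The machine halts when the transition function returns [None]. *)
Record turing_machine (S : finType) := TuringMachine {
  tm_state : finType;
  tm_work : finType;
  tm_tapes : nat;
  tm_start : tm_state;
  tm_trans : tm_state -> tm_tapes.+1.-tuple (cell S tm_work) ->
             option (tm_state * tm_tapes.+1.-tuple (cell S tm_work * move))
}.

(* Two-way infinite tape: [tape_left] lists the cells to the left of the head,
   nearest first, and everything outside the two lists is blank. *)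
Record tape (S G : Type) := Tape {
  tape_left : seq (cell S G);
  tape_head : cell S G;
  tape_right : seq (cell S G)
}.

Definition tape_act S G (t : tape S G) (a : cell S G * move) : tape S G :=
  let: Tape l _ r := t in
  let: (x, m) := a in
  match m with
  | MoveLeft => Tape (behead l) (head None l) (x :: r)
  | Stay => Tape l x r
  | MoveRight => Tape (x :: l) (head None r) (behead r)
  end.

Definition tape_of_word S G (w : seq S) : tape S G :=
  let cs := [seq Some (inl s) | s <- w] in
  Tape [::] (head None cs) (behead cs).

Definition config S (M : turing_machine S) : Type :=
  (tm_state M * (tm_tapes M).+1.-tuple (tape S (tm_work M)))%type.

Definition init_config S (M : turing_machine S) (w : seq S) : config M :=
  (tm_start M,
   [tuple if i == ord0 then tape_of_word (tm_work M) w
          else tape_of_word (tm_work M) [::] | i < (tm_tapes M).+1]).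

Definition step S (M : turing_machine S) (c : config M) : option (config M) :=
  let: (q, ts) := c in
  match tm_trans q [tuple tape_head (tnth ts i) | i < (tm_tapes M).+1] with
  | Some (q', acts) =>
      Some (q', [tuple tape_act (tnth ts i) (tnth acts i)
                | i < (tm_tapes M).+1])
  | None => None
  end.

(* Halting configurations are fixed, so [run n] performs at most [n] steps. *)
Definition run S (M : turing_machine S) (n : nat) (c : config M) : config M :=
  iter n (fun c => odflt c (step c)) c.

(* The output is the word starting under the head and extending to the right
   up to the first blank, and it has to consist of symbols of [S]. *)
Definition has_output S (M : turing_machine S) (c : config M) (v : seq S) :
    Prop :=
  let t := tnth c.2 ord_max in
  exists r : seq (cell S (tm_work M)),
    tape_head t :: tape_right t ++ [:: None] =
    [seq Some (inl s) | s <- v] ++ None :: r.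

Definition computes_within S (M : turing_machine S) (w v : seq S) (t : nat) :
    Prop :=
  let c := run t (init_config M w) in step c = None /\ has_output c v.

(* A search problem: [good x a] means that [a] is a correct answer to [x]. A
   single machine and a single polynomial serve all instances. *)
Definition poly_time_solvable (S : finType) (X : Type) (Y : X -> Type)
    (enc_in : X -> seq S) (enc_out : forall x, Y x -> seq S)
    (good : forall x, Y x -> Prop) : Prop :=
  exists (M : turing_machine S) (p : {poly nat}),
    forall x : X, exists2 a : Y x, good x a &
      computes_within M (enc_in x) (enc_out x a) p.[size (enc_in x)]%R.

Definition users_of (U R : finType) (A : {set U * R}) (r : R) : {set U} :=
  [set u | (u, r) \in A].

Definition complete (U R : finType) (A : {set U * R}) : Prop :=
  forall r : R, users_of A r != set0.

(* The pair [(r, r')] stands for the constraint (r, r', <->, forall). *)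
Definition sat_bodu (U R : finType) (A : {set U * R}) (c : R * R) : Prop :=
  users_of A c.1 = users_of A c.2.

Record bodu_instance := BodUInstance {
  users : finType;
  resources : finType;
  base_auth : {set users * resources};
  base_auth_complete : complete base_auth;
  constraints : {set resources * resources}
}.

Definition relation_of (x : bodu_instance) : Type :=
  {set users x * resources x}.

Definition authorized (x : bodu_instance) (A : relation_of x) : Prop :=
  A \subset base_auth x.

Definition eligible (x : bodu_instance) (A : relation_of x) : Prop :=
  forall c, c \in constraints x -> sat_bodu A c.

Definition valid (x : bodu_instance) (A : relation_of x) : Prop :=
  [/\ authorized A, complete A & eligible A].

Definition correct_answer (x : bodu_instance) (a : option (relation_of x)) :
    Prop :=
  match a with
  | Some A => valid A
  | None => ~ exists A : relation_of x, valid A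
  end.

(* Words are over [option bool]: [Some b] is a bit, [None] a separator that ends
   each row of the 0/1 matrix. *)
Definition enc_matrix (I J : finType) (P : I -> J -> bool) :
    seq (option bool) :=
  flatten [seq rcons [seq Some (P i j) | j <- enum J] None | i <- enum I].

Definition enc_relation (U R : finType) (A : {set U * R}) :
    seq (option bool) :=
  enc_matrix (fun (r : R) (u : U) => (u, r) \in A).

(* A row of [base_auth x] for each resource, then a separator (hence two in a
   row, since a resource exists only if a user does), then the adjacency matrix
   of [constraints x]. *)
Definition enc_instance (x : bodu_instance) : seq (option bool) :=
  enc_relation (base_auth x) ++
  None :: enc_matrix (fun r r' => (r, r') \in constraints x).

Definition enc_answer (x : bodu_instance) (a : option (relation_of x)) :
    seq (option bool) :=
  match a with
  | Some A => Some true :: enc_relation A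
  | None => [:: Some false]
  end.

(* Main.v *)
(* Keep two copies X and Y of the base authorization matrix, with a row for each
   resource. Whenever (r, r') is a constraint, or r = r', replace both row r of
   X and row r' of Y by their intersection. Every valid relation stays below X
   and Y, and every pass that changes something removes an entry, so a fixpoint
   is reached after linearly many passes; there X = Y satisfies all the
   constraints and is the largest candidate, whence a valid relation exists iff
   X has no empty row. The machine is obtained by compiling a while-program over
   four tapes. *)

Require Import Defs.
From mathcomp Require Import all_boot all_order all_algebra.
From mathcomp Require Import zify.

Set Implicit Arguments.
Unset Strict Implicit.
Unset Printing Implicit Defensive.

(** Intersecting two rows of a single copy would make one head travel back and forth between them;
    with the copies on separate tapes, each row has a head of its own and the intersection is
    computed in one sweep. The copies hold at most 2|R||U| entries together, so there are at most
    2|R||U| + 1 passes, the last of which changes nothing. A pass costs on the order of |R|^2 |U|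
    steps, up to lower-order terms, because the head of Y sweeps all rows for every row of X. The
    number of passes is linear in the input length and the cost of a pass is at most quadratic,
    hence the cubic bound. The machine model stores visited blanks, so equal tape contents may have
    different representations; all reasoning about programs is therefore done on tapes without
    trailing blanks. *)

(** * Tapes modulo trailing blanks *)

Section NormalizedTapes.

Variables S G : Type.
Implicit Types (x : cell S G) (l s : seq (cell S G)).

(* Blanks at the far end of a half-tape are never stored. *)
Definition pcons x l := if x is None then if l is [::] then [::] else x :: l
                        else x :: l.

Definition trim := foldr pcons [::].

Definition ztape : Type := seq (cell S G) * seq (cell S G).

Definition norm (t : tape S G) : ztape :=
  (trim (tape_left t), trim (tape_head t :: tape_right t)).

Definition zread (z : ztape) : cell S G := head None z.2.

Definition zmove (m : move) (z : ztape) : ztape :=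
  match m with
  | MoveLeft => (behead z.1, pcons (head None z.1) z.2)
  | Stay => z
  | MoveRight => (pcons (head None z.2) z.1, behead z.2)
  end.

(* [None] in the first component leaves the cell as it is, whereas
   [Some None] erases it. *)
Definition action : Type := option (cell S G) * move.

Definition zact (z : ztape) (a : action) : ztape :=
  zmove a.2 (z.1, if a.1 is Some x then pcons x (behead z.2) else z.2).

Lemma head_pcons x l : head None (pcons x l) = x.
Proof. by case: x l => [x|] []. Qed.

Lemma behead_pcons x l : behead (pcons x l) = l.
Proof. by case: x l => [x|] []. Qed.

Lemma head_trim l : head None (trim l) = head None l.
Proof. by case: l => //= x l; rewrite head_pcons. Qed.

Lemma behead_trim l : behead (trim l) = trim (behead l).
Proof. by case: l => //= x l; rewrite behead_pcons. Qed.

Lemma pcons_trim l : pcons (head None l) (trim (behead l)) = trim l.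
Proof. by case: l. Qed.

Lemma zread_norm t : zread (norm t) = tape_head t.
Proof. by rewrite /zread head_trim. Qed.

(** A machine has to write in every step, so an action that leaves the cell alone is realized by
    rewriting the symbol under the head. *)
Lemma norm_act t (a : action) :
  norm (tape_act t (odflt (tape_head t) a.1, a.2)) = zact (norm t) a.
Proof.
case: t a => l h r [w []]; rewrite /norm /zact /= ?behead_pcons ?pcons_trim;
  by case: w => [x|] /=; rewrite ?head_pcons ?behead_trim ?behead_pcons ?head_trim.
Qed.

Lemma trim_pad s : exists k, s = trim s ++ nseq k None.
Proof.
elim: s => [|x s [k IHs]] /=; first by exists 0.
have [xs0|] := eqVneq (size (pcons x (trim s))) 0; last first.
  move=> nz; exists k; rewrite {1}IHs.
  by case: x nz => [x|] //=; case: (trim s).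
by exists k.+1; case: x xs0 => // ; rewrite {2}IHs; case: (trim s).
Qed.

(** A word can end in two ways, which are the two shapes of [pcons None s]: at the end of the stored
    tape, where the blank appended in the conclusion terminates it, or at a stored blank followed by
    other cells. *)
Lemma norm_output (t : tape S G) (v : seq S) s :
  (norm t).2 = [seq Some (inl y) | y <- v] ++ pcons None s ->
  exists r, tape_head t :: tape_right t ++ [:: None] =
            [seq Some (inl y) | y <- v] ++ None :: r.
Proof.
rewrite /norm -cat_cons; have [k {2}->] := trim_pad (tape_head t :: tape_right t).
move=> /= ->; case: s => [|y s]; rewrite -!catA /=.
  by exists (nseq k None); congr cat; elim: k => //= k ->.
by eexists.
Qed.

End NormalizedTapes.

(** * While-programs and their compilation to Turing machines *)

Section Programs.

Variables (S G : finType) (n : nat).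

Local Notation heads := {ffun 'I_n.+1 -> cell S G}.
Local Notation acts := {ffun 'I_n.+1 -> action S G}.
Local Notation zstate := {ffun 'I_n.+1 -> ztape S G}.

Implicit Types (f : heads -> acts) (g : heads -> bool) (z : zstate).

Inductive cmd :=
| Do of heads -> acts
| Seq of cmd & cmd
| If of (heads -> bool) & cmd & cmd
| While of (heads -> bool) & cmd.

Definition zheads (z : zstate) : heads := [ffun i => zread (z i)].

Definition zacts (z : zstate) (a : acts) : zstate := [ffun i => zact (z i) (a i)].

(** The number counts the steps of the compiled machine exactly: a test takes a step of its own,
    whereas [Seq] adds none, since control passes on during the last step of the first command. *)
Inductive exec : cmd -> zstate -> nat -> zstate -> Prop :=
| ExecDo f z : exec (Do f) z 1 (zacts z (f (zheads z)))
| ExecSeq a b z1 z2 z3 m k :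
    exec a z1 m z2 -> exec b z2 k z3 -> exec (Seq a b) z1 (m + k) z3
| ExecIfT g a b z z' m :
    g (zheads z) -> exec a z m z' -> exec (If g a b) z m.+1 z'
| ExecIfF g a b z z' m :
    ~~ g (zheads z) -> exec b z m z' -> exec (If g a b) z m.+1 z'
| ExecWhileT g a z1 z2 z3 m k :
    g (zheads z1) -> exec a z1 m z2 -> exec (While g a) z2 k z3 ->
    exec (While g a) z1 (m + k).+1 z3
| ExecWhileF g a z : ~~ g (zheads z) -> exec (While g a) z 1 z.

Fixpoint label (c : cmd) : finType :=
  match c with
  | Do _ => unit
  | Seq a b => (label a + label b)%type
  | If _ a b => option (label a + label b)
  | While _ a => option (label a)
  end.

Fixpoint entry (c : cmd) : label c :=
  match c with
  | Do _ => tt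
  | Seq a b => inl (entry a)
  | If _ _ _ => None
  | While _ _ => None
  end.

Definition idle : acts := [ffun=> (None, Stay)].

(* The label [None] means that control leaves the command. *)
Fixpoint delta (c : cmd) : label c -> heads -> option (label c) * acts :=
  match c with
  | Do f => fun _ h => (None, f h)
  | Seq a b => fun q h =>
      match q with
      | inl q => let: (o, x) := delta q h in
                 (Some (if o is Some q' then inl q' else inr (entry b)), x)
      | inr q => let: (o, x) := delta q h in (omap inr o, x)
      end
  | If g a b => fun q h =>
      match q with
      | None => (Some (Some (if g h then inl (entry a) else inr (entry b))), idle)
      | Some (inl q) => let: (o, x) := delta q h in (omap (Some \o inl) o, x)
      | Some (inr q) => let: (o, x) := delta q h in (omap (Some \o inr) o, x)
      end
  | While g a => fun q h =>
      match q with
      | None => (if g h then Some (Some (entry a)) else None, idle)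
      | Some q => let: (o, x) := delta q h in (Some o, x)
      end
  end.

Inductive exits (c : cmd) : label c -> zstate -> nat -> zstate -> Prop :=
| ExitsLast q z a : delta q (zheads z) = (None, a) -> exits q z 1 (zacts z a)
| ExitsStep q q' z a m z' :
    delta q (zheads z) = (Some q', a) -> exits q' (zacts z a) m z' ->
    exits q z m.+1 z'.

Lemma zacts_idle z : zacts z idle = z.
Proof. by apply/ffunP => i; rewrite !ffunE /zact /=; case: (z i). Qed.

Lemma exits_seq a b (q : label a) z m z' k z'' :
  exits q z m z' -> exits (inr (entry b) : label (Seq a b)) z' k z'' ->
  exits (inl q : label (Seq a b)) z (m + k) z''.
Proof.
move=> E F; elim: E F => {q z m z'} [q z x|q q' z x m z'] d.
  by rewrite add1n; apply: (@ExitsStep (Seq a b)); rewrite /= d.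
by move=> _ IH /IH; rewrite addSn; apply: (@ExitsStep (Seq a b)); rewrite /= d.
Qed.

(** This serves the subcommands whose exit is an exit of the whole: the second half of [Seq] and the
    branches of [If]. The first half of [Seq] and the body of [While] have their exit redirected,
    which is why they are treated separately. *)
Lemma exits_embed a c (j : label a -> label c) :
  (forall q h, delta (j q) h = (omap j (delta q h).1, (delta q h).2)) ->
  forall q z m z', exits q z m z' -> exits (j q) z m z'.
Proof.
move=> jE q z m z'; elim=> {q z m z'} [q z x|q q' z x m z'] d.
  by apply: ExitsLast; rewrite jE d.
by move=> _; apply: ExitsStep; rewrite jE d.
Qed.

Lemma exits_while g a (q : label a) z m z' k z'' :
  exits q z m z' -> exits (None : label (While g a)) z' k z'' ->
  exits (Some q : label (While g a)) z (m + k) z''.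
Proof.
move=> E F; elim: E F => {q z m z'} [q z x|q q' z x m z'] d.
  by rewrite add1n; apply: (@ExitsStep (While g a)); rewrite /= d.
by move=> _ IH /IH; rewrite addSn; apply: (@ExitsStep (While g a)); rewrite /= d.
Qed.

Lemma exec_exits c z m z' : exec c z m z' -> exits (entry c) z m z'.
Proof.
elim=> {c z m z'}.
- by move=> f z; apply: ExitsLast.
- move=> a b z1 z2 z3 m k _ Ha _ Hb; apply: exits_seq Ha _.
  apply: (@exits_embed _ (Seq a b) inr) Hb.
  by move=> q h /=; case: (delta q h).
- move=> g a b z z' m gz _ Ha.
  apply: (@ExitsStep (If g a b) None _ _ idle); first by rewrite /= gz.
  rewrite zacts_idle; apply: (@exits_embed _ (If g a b) (Some \o inl)) Ha.
  by move=> q h /=; case: (delta q h).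
- move=> g a b z z' m gz _ Ha.
  apply: (@ExitsStep (If g a b) None _ _ idle); first by rewrite /= (negPf gz).
  rewrite zacts_idle; apply: (@exits_embed _ (If g a b) (Some \o inr)) Ha.
  by move=> q h /=; case: (delta q h).
- move=> g a z1 z2 z3 m k gz _ Ha _ Hw.
  apply: (@ExitsStep (While g a) None _ _ idle); first by rewrite /= gz.
  by rewrite zacts_idle; apply: exits_while Ha Hw.
- move=> g a z gz; rewrite -{2}(zacts_idle z).
  by apply: (@ExitsLast (While g a)); rewrite /= (negPf gz).
Qed.

Definition machine (c : cmd) : turing_machine S :=
  @TuringMachine S (option (label c)) G n (Some (entry c))
    (fun q hs => if q is Some q then
       let: h := [ffun i => tnth hs i] in let: (o, a) := delta q h in
       Some (o, [tuple (odflt (h i) (a i).1, (a i).2) | i < n.+1])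
     else None).

Definition znorm (ts : n.+1.-tuple (tape S G)) : zstate :=
  [ffun i => norm (tnth ts i)].

Lemma step_machine c (q : label c) ts o a :
  delta q (zheads (znorm ts)) = (o, a) ->
  exists2 ts', @step S (machine c) (Some q, ts) = Some (o, ts') &
               znorm ts' = zacts (znorm ts) a.
Proof.
move=> d; rewrite /step /=; set h := [ffun i => _].
have -> : h = zheads (znorm ts).
  by apply/ffunP => i; rewrite !ffunE zread_norm tnth_mktuple.
rewrite d; eexists; first reflexivity.
by apply/ffunP => i; rewrite !ffunE !tnth_mktuple !ffunE zread_norm norm_act.
Qed.

Lemma run_machine c (q : label c) z m z' :
  exits q z m z' -> forall ts, znorm ts = z ->
  exists2 ts', @run S (machine c) m (Some q, ts) = (None, ts') & znorm ts' = z'.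
Proof.
elim=> {q z m z'} [q z a|q q' z a m z'] d.
  move=> ts tsz; rewrite -tsz in d *.
  by have [ts' /= E <-] := step_machine d; exists ts'; rewrite // /run /= E.
move=> _ IH ts tsz; rewrite -tsz in d.
have [ts1 E E1] := step_machine d; have [|ts' R N] := IH ts1; first by rewrite E1 tsz.
by exists ts'; rewrite // /run iterSr [odflt _ _](_ : _ = (Some q', ts1)) // E.
Qed.

Lemma machine_computes c (w v : seq S) m t z s :
  exec c [ffun i => ([::], if i == ord0 then [seq Some (inl x) | x <- w] else [::])]
    m z -> m <= t ->
  (z ord_max).2 = [seq Some (inl x) | x <- v] ++ pcons None s ->
  @computes_within S (machine c) w v t.
Proof.
move=> /exec_exits E mt out.
have [|ts R N] := run_machine E (ts := (init_config (machine c) w).2).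
  have tw (u : seq S) : norm (tape_of_word G u) = ([::], [seq Some (inl x) | x <- u]).
    rewrite /tape_of_word /norm /=; congr pair.
    rewrite pcons_trim; elim: u => //= x u ->; by [].
  by apply/ffunP => i; rewrite !ffunE tnth_mktuple /=; case: ifP; rewrite tw.
rewrite /computes_within; have -> : run t (init_config (machine c) w) = (None, ts).
  rewrite -(subnK mt) /run iterD [iter m _ _]R.
  (* The machine has halted after [m] steps, so the remaining [t - m] iterations change nothing. *)
  by elim: (t - m) => //= k ->.
by split=> //; apply: (@norm_output _ _ _ _ s); rewrite -out -N !ffunE.
Qed.

Definition runs c z b z' := exists2 m, m <= b & exec c z m z'.

End Programs.

(** * Composition rules for upper bounds on the running time *)

Section TimedExecution.

Variables (S G : finType) (n : nat).
Implicit Types (c : cmd S G n) (z : {ffun 'I_n.+1 -> ztape S G}).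

Lemma runs_le b b' c z z' : b <= b' -> runs c z b z' -> runs c z b' z'.
Proof. by move=> bb' [m /leq_trans/(_ bb') mb' E]; exists m. Qed.

Lemma runs_do f z z' : zacts z (f (zheads z)) = z' -> runs (Do f) z 1 z'.
Proof. by move=> <-; exists 1 => //; apply: ExecDo. Qed.

Lemma runs_seq c1 c2 z z1 z2 b1 b2 :
  runs c1 z b1 z1 -> runs c2 z1 b2 z2 -> runs (Seq c1 c2) z (b1 + b2) z2.
Proof.
by move=> [m1 m1b E1] [m2 m2b E2]; exists (m1 + m2); [exact: leq_add|exact: ExecSeq E1 E2].
Qed.

Lemma runs_if (g : {ffun _ -> _} -> bool) c1 c2 z z' b :
  runs (if g (zheads z) then c1 else c2) z b z' -> runs (If g c1 c2) z b.+1 z'.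
Proof.
case: ifPn => gz [m mb E]; exists m.+1 => //; [exact: ExecIfT|exact: ExecIfF].
Qed.

Lemma runs_while (g : {ffun _ -> _} -> bool) c z z1 z2 b1 b2 :
  g (zheads z) -> runs c z b1 z1 -> runs (While g c) z1 b2 z2 ->
  runs (While g c) z (b1 + b2).+1 z2.
Proof.
move=> gz [m1 m1b E1] [m2 m2b E2]; exists (m1 + m2).+1; first exact: leq_add.
exact: ExecWhileT E1 E2.
Qed.

Lemma runs_while_stop (g : {ffun _ -> _} -> bool) c z : ~~ g (zheads z) -> runs (While g c) z 1 z.
Proof. by move=> gz; exists 1 => //; apply: ExecWhileF. Qed.

End TimedExecution.

(** * Moving one head along a word *)

Local Notation sym := (option bool).
Local Notation zt := (ztape sym void).
Local Notation cmd4 := (cmd sym void 3).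
Local Notation heads4 := {ffun 'I_4 -> cell sym void}.
Local Notation zst := {ffun 'I_4 -> zt}.

(** The separator [cs None] is a symbol and differs from the blank cell [None]. The input symbols
    and the blank suffice for the programs below, so the type of work symbols is [void]. *)
Definition cs (x : sym) : cell sym void := Some (inl x).

Definition wtape (l s : seq sym) : zt := (map cs l, map cs s).

Section SingleTape.

Implicit Types (z : zst) (k : 'I_4) (t : zt).

Definition upd z k t : zst := [ffun i => if i == k then t else z i].

Definition on k (p : pred sym) (h : heads4) : bool :=
  if h k is Some (inl x) then p x else false.

Definition mv k m : cmd4 := Do (fun _ => [ffun i => (None, if i == k then m else Stay)]).

Definition skip k p := While (on k p) (mv k MoveRight).

(** The head starts just to the right of the word, hence the initial move to the left; the loop
    overshoots by one cell, hence the final move to the right. *)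
Definition rewind k p :=
  Seq (mv k MoveLeft) (Seq (While (on k p) (mv k MoveLeft)) (mv k MoveRight)).

Lemma runs_mv k m z : runs (mv k m) z 1 (upd z k (zmove m (z k))).
Proof.
apply: runs_do; apply/ffunP => i; rewrite !ffunE /zact /=.
by case: eqP => [->|_]; case: (z _).
Qed.

Lemma upd_upd z k t t' : upd (upd z k t) k t' = upd z k t'.
Proof. by apply/ffunP => i; rewrite !ffunE; case: eqP. Qed.

Lemma upd_same z k t : z k = t -> upd z k t = z.
Proof. by move=> <-; apply/ffunP => i; rewrite !ffunE; case: eqP => [->|]. Qed.

Lemma updE z k t : upd z k t k = t.
Proof. by rewrite ffunE eqxx. Qed.

Lemma on_wtape k p z l s : z k = wtape l s -> on k p (zheads z) = oapp p false (ohead s).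
Proof. by move=> zk; rewrite /on ffunE zk; case: s {zk}. Qed.

Lemma runs_mvr k z l x s :
  z k = wtape l (x :: s) -> runs (mv k MoveRight) z 1 (upd z k (wtape (x :: l) s)).
Proof. by move=> zk; have := runs_mv k MoveRight z; rewrite zk. Qed.

Lemma runs_skip k p w l s z :
  z k = wtape l (w ++ s) -> all p w -> oapp p false (ohead s) = false ->
  runs (skip k p) z (2 * size w).+1 (upd z k (wtape (rev w ++ l) s)).
Proof.
elim: w l z => [|x w IHw] l z zk /= => [_ ps|/andP[px pw] ps].
  by rewrite upd_same //; apply: runs_while_stop; rewrite (on_wtape _ zk) ps.
apply: (@runs_le _ _ _ (1 + (2 * size w).+1).+1); first by lia.
apply: runs_while (runs_mvr zk) _; first by rewrite (on_wtape _ zk).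
have := IHw (x :: l) _ (updE _ _ _) pw ps.
by move=> /(_ z); rewrite upd_upd rev_cons cat_rcons.
Qed.

Lemma runs_rewind k p w l s z :
  z k = wtape (rev w ++ l) s -> all p w -> oapp p false (ohead l) = false ->
  runs (rewind k p) z (2 * size w + 3) (upd z k (wtape l (w ++ s))).
Proof.
move=> zk pw pl.
(* The invariant is stated for the head one cell further left, as it is inside the loop; this also
   makes sense for empty [v] and [l], where the head is on the blank left of the tape contents. *)
suff loop v (t : seq sym) : all p v -> runs (While (on k p) (mv k MoveLeft))
    (upd z k (zmove MoveLeft (wtape (v ++ l) t))) (2 * size v).+1
    (upd z k (zmove MoveLeft (wtape l (rev v ++ t)))).
  apply: (@runs_le _ _ _ (1 + ((2 * size w).+1 + 1))); first by lia.
  apply: runs_seq (runs_mv _ _ _) _; rewrite zk.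
  apply: runs_seq; first by have := loop (rev w) s; rewrite all_rev size_rev; exact.
  have := runs_mv k MoveRight (upd z k (zmove MoveLeft (wtape l (rev (rev w) ++ s)))).
  rewrite updE upd_upd revK; congr (runs _ _ _ (upd _ _ _)).
  rewrite /= head_pcons behead_pcons /wtape; case: l {zk pl loop} => //=.
elim: v t => [|x v IHv] t /=.
  move=> _; apply: runs_while_stop.
  rewrite /on ffunE updE /zread /= head_pcons.
  by case: l pl {zk} => //= x l ->.
move=> /andP[px pv].
apply: (@runs_le _ _ _ (1 + (2 * size v).+1).+1); first by lia.
apply: runs_while (runs_mv _ _ _) _.
  by rewrite /on ffunE updE.
rewrite updE upd_upd; have := IHv (x :: t) pv.
by rewrite rev_cons cat_rcons.
Qed.

End SingleTape.

(** * The four tapes and the intersection of two rows *)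

Definition vec4 T (a b c d : T) : {ffun 'I_4 -> T} := [ffun i => tnth [tuple a; b; c; d] i].

(* [tC] is the input tape, on which only the matrix of constraints is left once
   the authorization matrix has been moved to [tX] and to the output tape [tY];
   [tF] has a flag in a single cell. *)
Local Notation tC := (@Ordinal 4 0 isT).
Local Notation tX := (@Ordinal 4 1 isT).
Local Notation tF := (@Ordinal 4 2 isT).
Local Notation tY := (@Ordinal 4 3 isT).

Lemma vec4E T (a b c d : T) :
  (vec4 a b c d tC = a) * (vec4 a b c d tX = b) * (vec4 a b c d tF = c) * (vec4 a b c d tY = d).
Proof. by rewrite !ffunE. Qed.

Lemma eq_vec4 T (z : {ffun 'I_4 -> T}) a b c d :
  z tC = a -> z tX = b -> z tF = c -> z tY = d -> z = vec4 a b c d.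
Proof.
move=> <- <- <- <-; apply/ffunP => -[[|[|[|[|]]]] lt_i] //;
  by rewrite ffunE; congr (z _); apply: val_inj.
Qed.

Lemma upd_vec4 (a b c d t : zt) :
  (upd (vec4 a b c d) tC t = vec4 t b c d) * (upd (vec4 a b c d) tX t = vec4 a t c d) *
  (upd (vec4 a b c d) tF t = vec4 a b t d) * (upd (vec4 a b c d) tY t = vec4 a b c t).
Proof. by do 3?split; apply: eq_vec4; rewrite !ffunE. Qed.

Lemma zheads_vec4 (a b c d : zt) :
  zheads (vec4 a b c d) = vec4 (zread a) (zread b) (zread c) (zread d).
Proof. by apply: eq_vec4; rewrite ffunE vec4E. Qed.

Lemma zacts_vec4 (a b c d : zt) x y u v :
  zacts (vec4 a b c d) (vec4 x y u v) = vec4 (zact a x) (zact b y) (zact c u) (zact d v).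
Proof. by apply: eq_vec4; rewrite ffunE !vec4E. Qed.

Definition nop : action sym void := (None, Stay).

Definition bits (J : Type) (P : pred J) (s : seq J) : seq sym := [seq Some (P j) | j <- s].

(* [sync] runs [meet] with a blank under the head of [tC], which must count as a
   constraint. *)
Definition active (h : heads4) := h tC != cs (Some false).

Definition and_step : cmd4 :=
  Do (fun h =>
    let x := h tX == cs (Some true) in
    let y := h tY == cs (Some true) in
    let a : action sym void :=
      (if active h then Some (cs (Some (x && y))) else None, MoveRight) in
    vec4 nop a (if active h && (x != y) then Some (cs (Some true)) else None, Stay) a).

Definition meet := While (on tX isSome) and_step.

Lemma runs_meet (U : Type) (P Q : pred U) us c a lx sx ly sy fl :
  (zread c != cs (Some false)) = a ->
  runs meet
    (vec4 c (wtape lx (bits P us ++ None :: sx)) (wtape [::] [:: Some fl])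
       (wtape ly (bits Q us ++ None :: sy)))
    (2 * size us).+1
    (vec4 c (wtape (rev (bits (fun u => if a then P u && Q u else P u) us) ++ lx) (None :: sx))
         (wtape [::] [:: Some (fl || (a && has (fun u => P u != Q u) us))])
         (wtape (rev (bits (fun u => if a then P u && Q u else Q u) us) ++ ly) (None :: sy))).
Proof.
move=> ca; elim: us lx ly fl => [|u us IHus] lx ly fl.
  by rewrite /= andbF orbF; apply: runs_while_stop; rewrite /on zheads_vec4 vec4E.
apply: (@runs_le _ _ _ (1 + (2 * size us).+1).+1); first by rewrite /=; lia.
apply: runs_while; first by rewrite /on zheads_vec4 vec4E.
  by apply: runs_do; rewrite zheads_vec4 /active !vec4E ca zacts_vec4.
rewrite [zact c nop](_ : _ = c); last by rewrite /zact /=; case: (c).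
set F := zact (wtape [::] [:: Some fl]) _.
have -> : F = wtape [::] [:: Some (fl || a && (P u != Q u))].
  rewrite /F /zact /zread /=; case: a {ca IHus F}; case: (P u); case: (Q u); case: fl => //=.
set x := zact _ _;
have -> : x = wtape (Some (if a then P u && Q u else P u) :: lx) (bits P us ++ None :: sx).
  by rewrite /x /zact /zread /=; case: a {ca IHus F x}; case: (P u); case: (Q u).
set y := zact _ _;
have -> : y = wtape (Some (if a then P u && Q u else Q u) :: ly) (bits Q us ++ None :: sy).
  by rewrite /y /zact /zread /=; case: a {ca IHus F x y}; case: (P u); case: (Q u).
by rewrite /= !rev_cons !cat_rcons andb_orr orbA; apply: IHus.
Qed.

(** While the head of [tC] is at entry (i, j), those of [tX] and [tY] are at the starts of rows i
    and j. After [meet] only the row of [tX] is rewound, since the next entry is (i, j+1). *)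
Definition scan_bit : cmd4 :=
  Seq meet (Seq (mv tY MoveRight) (Seq (mv tC MoveRight) (rewind tX isSome))).

(** At the end of row i of the constraints, [tX] advances to row i+1 and [tY] returns to row 0. *)
Definition scan_sep : cmd4 :=
  Seq (mv tC MoveRight)
      (Seq (skip tX isSome) (Seq (mv tX MoveRight) (rewind tY predT))).

Definition scan : cmd4 := While (on tC predT) (If (on tC isSome) scan_bit scan_sep).

Definition sync : cmd4 :=
  While (on tX predT) (Seq meet (Seq (mv tX MoveRight) (mv tY MoveRight))).

Definition rows (I : Type) (J : finType) (P : I -> pred J) (s : seq I) : seq sym :=
  flatten [seq bits (P i) (enum J) ++ [:: None] | i <- s].

Lemma enc_matrixE (I J : finType) (P : I -> J -> bool) : enc_matrix P = rows P (enum I).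
Proof. by congr flatten; apply: eq_map => i; rewrite cats1. Qed.

Lemma size_bits (J : Type) (P : pred J) s : size (bits P s) = size s.
Proof. exact: size_map. Qed.

Lemma rows_cons (I : Type) (J : finType) (P : I -> pred J) i s :
  rows P (i :: s) = bits (P i) (enum J) ++ None :: rows P s.
Proof. by rewrite /rows /= -catA. Qed.

Lemma size_rows (I : Type) (J : finType) (P : I -> pred J) s :
  size (rows P s) = size s * #|J|.+1.
Proof.
by elim: s => // i s IHs; rewrite rows_cons size_cat size_map /= IHs -cardE mulSn addSnnS.
Qed.

Lemma eq_rows (I : eqType) (J : finType) (P Q : I -> pred J) (s : seq I) :
  {in s, forall i, P i =1 Q i} -> rows P s = rows Q s.
Proof.
move=> PQ; congr flatten; apply/eq_in_map => i /PQ e; congr (_ ++ _).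
by apply: eq_map => j; rewrite e.
Qed.

(** * A pass as a sequence of abstract edge steps *)

Section Edges.

Variables R U : finType.

Local Notation auth := {ffun R -> {set U}}.

Definition fupd (f : auth) r A : auth := [ffun k => if k == r then A else f k].

(* The state consists of the flag and the contents of [tX] and [tY]. *)
Definition edge_step (c : rel R) (st : bool * (auth * auth)) (e : R * R) :=
  if c e.1 e.2 then
    let A := st.2.1 e.1 :&: st.2.2 e.2 in
    (st.1 || (st.2.1 e.1 != st.2.2 e.2), (fupd st.2.1 e.1 A, fupd st.2.2 e.2 A))
  else st.

Definition edges c := foldl (edge_step c).

Definition mem_of (f : auth) r : pred U := fun u => u \in f r.

Implicit Types (c : rel R).

(** Rows that are yet to be visited, or are already left behind, can thus be described by whichever
    intermediate state is convenient. *)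
Lemma edges_otherl c st s r : r \notin map fst s -> (edges c st s).2.1 r = st.2.1 r.
Proof.
elim: s st => //= e s IHs st; rewrite inE negb_or => /andP[/negPf re rs].
by rewrite IHs // /edge_step; case: ifP => //= _; rewrite ffunE re.
Qed.

Lemma edges_otherr c st s r : r \notin map snd s -> (edges c st s).2.2 r = st.2.2 r.
Proof.
elim: s st => //= e s IHs st; rewrite inE negb_or => /andP[/negPf re rs].
by rewrite IHs // /edge_step; case: ifP => //= _; rewrite ffunE re.
Qed.

Definition tapes (lc sc lx sx : seq sym) fl ly sy : zst :=
  vec4 (wtape lc sc) (wtape lx sx) (wtape [::] [:: Some fl]) (wtape ly sy).

(** The hypothesis on [sc] covers both uses of [meet]: the head of [tC] on a bit of the matrix
    during [scan], and on a blank, which counts as an edge, during [sync]. *)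
Lemma runs_meet_edge (c : rel R) i j st lc sc lx sx ly sy :
  (ohead sc != Some (Some false)) = c i j ->
  let st' := edge_step c st (i, j) in
  runs meet
    (tapes lc sc lx (bits (mem_of st.2.1 i) (enum U) ++ None :: sx) st.1
             ly (bits (mem_of st.2.2 j) (enum U) ++ None :: sy))
    (2 * #|U|).+1
    (tapes lc sc (rev (bits (mem_of st'.2.1 i) (enum U)) ++ lx) (None :: sx) st'.1
             (rev (bits (mem_of st'.2.2 j) (enum U)) ++ ly) (None :: sy)).
Proof.
move=> Cij st'.
have {}Cij : (zread (wtape lc sc) != cs (Some false)) = c i j.
  by rewrite -Cij; case: sc {Cij}.
have := runs_meet (mem_of st.2.1 i) (mem_of st.2.2 j) (enum U) lx sx ly sy st.1 Cij.
rewrite -cardE /tapes;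
congr (runs _ _ _ (vec4 _ (wtape (rev _ ++ _) _) (wtape _ [:: Some _]) (wtape (rev _ ++ _) _))).
- apply: eq_map => u; rewrite /st' /mem_of /edge_step /=.
  by case: ifP => //= _; rewrite ffunE eqxx inE.
- rewrite /st' /edge_step /=; case: (c i j) => /=; last by rewrite orbF.
  congr orb; apply/hasP/idP => [[u _]|ne]; first by apply: contraNneq => E; rewrite /mem_of E.
  have [u ne'|E] := pickP (fun u => mem_of st.2.1 i u != mem_of st.2.2 j u).
    by exists u; rewrite ?mem_enum.
  by case/eqP: ne; apply/setP => u; have /negbFE/eqP := E u.
- apply: eq_map => u; rewrite /st' /mem_of /edge_step /=.
  by case: ifP => //= _; rewrite ffunE eqxx inE.
Qed.

Lemma runs_sync c st s lc lx ly : uniq s -> (forall r, r \in s -> c r r) ->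
  let st' := edges c st [seq (r, r) | r <- s] in
  runs sync (tapes lc [::] lx (rows (mem_of st.2.1) s) st.1 ly (rows (mem_of st.2.2) s))
    (size s * (2 * #|U| + 4)).+1
    (tapes lc [::] (rev (rows (mem_of st'.2.1) s) ++ lx) [::] st'.1
               (rev (rows (mem_of st'.2.2) s) ++ ly) [::]).
Proof.
elim: s st lx ly => [|r s IHs] st lx ly.
  by move=> _ _; apply: runs_while_stop; rewrite /on zheads_vec4 vec4E.
rewrite cons_uniq => /andP[rs us] cr st'; rewrite !rows_cons.
apply: (@runs_le _ _ _ ((2 * #|U|).+1 + (1 + 1) + (size s * (2 * #|U| + 4)).+1).+1).
  by rewrite [size (_ :: _)]/=; move: (size s) (#|U|) => a k; nia.
apply: runs_while; first by rewrite /on zheads_vec4 vec4E; case: (enum U).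
  apply: runs_seq; first by apply: (@runs_meet_edge c); rewrite cr ?mem_head.
  set st1 := edge_step _ _ _.
  by apply: runs_seq; apply: runs_mvr; rewrite ?upd_vec4 vec4E.
rewrite !upd_vec4; set st1 := edge_step _ _ _.
have rs1 : r \notin map fst [seq (r, r) | r <- s] by rewrite -map_comp map_id_in.
have rs2 : r \notin map snd [seq (r, r) | r <- s] by rewrite -map_comp map_id_in.
have E1 : rows (mem_of st.2.1) s = rows (mem_of st1.2.1) s.
  apply: eq_rows => k ks u; rewrite /mem_of.
  rewrite -[st1](_ : edges c st [:: (r, r)] = _) // edges_otherl //= inE.
  by apply: contraNneq rs => <-.
have E2 : rows (mem_of st.2.2) s = rows (mem_of st1.2.2) s.
  apply: eq_rows => k ks u; rewrite /mem_of.
  rewrite -[st1](_ : edges c st [:: (r, r)] = _) // edges_otherr //= inE.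
  by apply: contraNneq rs => <-.
have := IHs st1 (None :: rev (bits (mem_of st1.2.1 r) (enum U)) ++ lx)
  (None :: rev (bits (mem_of st1.2.2 r) (enum U)) ++ ly) us.
move=> /(_ (fun k ks => cr k (mem_behead (s := r :: s) ks))).
rewrite -/(tapes _ _ _ _ _ _ _) E1 E2.
rewrite /st' !rev_cat !rev_cons !cat_rcons -!catA.
rewrite [edges c st _]/= -/st1.
have -> : mem_of (edges c st1 [seq (r0, r0) | r0 <- s]).2.1 r = mem_of st1.2.1 r.
  by rewrite /mem_of edges_otherl.
have -> : mem_of (edges c st1 [seq (r0, r0) | r0 <- s]).2.2 r = mem_of st1.2.2 r.
  by rewrite /mem_of edges_otherr.
by [].
Qed.

(** One row is not a subcommand but a stretch of iterations of the loop [scan], so the claim takes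
    the rest of the loop as a hypothesis. The condition on [lx] says that a separator or the end of
    the tape stops the rewinding of the row of [tX]. *)
Lemma runs_scan_row c i s st lc sc lx sx ly b z : uniq s ->
  oapp isSome false (ohead lx) = false ->
  let st' := edges c st [seq (i, j) | j <- s] in
  runs scan (tapes (rev (bits (c i) s) ++ lc) (None :: sc)
               lx (bits (mem_of st'.2.1 i) (enum U) ++ None :: sx) st'.1
               (rev (rows (mem_of st'.2.2) s) ++ ly) [::]) b z ->
  runs scan (tapes lc (bits (c i) s ++ None :: sc)
               lx (bits (mem_of st.2.1 i) (enum U) ++ None :: sx) st.1
               ly (rows (mem_of st.2.2) s)) (size s * (4 * #|U| + 8) + b) z.
Proof.
elim: s st lc ly => [|j s IHs] st lc ly //; rewrite cons_uniq => /andP[js us] lx0.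
set st1 := edge_step c st (i, j); move=> st' run.
rewrite rows_cons.
apply: (@runs_le _ _ _ (((2 * #|U|).+1 + (1 + (1 +
  (2 * size (bits (mem_of st1.2.1 i) (enum U)) + 3)))).+1 + (size s * (4 * #|U| + 8) + b)).+1).
  by rewrite size_map -cardE [size (_ :: _)]/=; move: (size s) (#|U|) => a k; nia.
apply: runs_while; first by rewrite /on zheads_vec4 vec4E.
  apply: runs_if; rewrite /on zheads_vec4 vec4E /=.
  apply: runs_seq; first by apply: (@runs_meet_edge c i j) => /=; case: (c i j).
  rewrite -/st1; apply: runs_seq; first by apply: runs_mvr; rewrite vec4E.
  rewrite upd_vec4; apply: runs_seq; first by apply: runs_mvr; rewrite vec4E.
  rewrite upd_vec4; apply: (@runs_rewind _ _ (bits (mem_of st1.2.1 i) (enum U)) lx).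
  - by rewrite vec4E.
  - by apply/allP => x /mapP[u _ ->].
  - exact: lx0.
rewrite upd_vec4 -/(tapes _ _ _ _ _ _ _).
have E2 : rows (mem_of st.2.2) s = rows (mem_of st1.2.2) s.
  apply: eq_rows => k ks u; rewrite /mem_of.
  rewrite -[st1](_ : edges c st [:: (i, j)] = _) // edges_otherr //= inE.
  by apply: contraNneq js => <-.
rewrite E2; apply: IHs => //; rewrite -/st'.
move: run; rewrite rows_cons rev_cons cat_rcons rev_cat rev_cons cat_rcons -catA /=.
have -> // : mem_of st'.2.2 j = mem_of st1.2.2 j.
rewrite /mem_of -[st'](_ : edges c st1 [seq (i, j) | j <- s] = _) //.
by rewrite edges_otherr // -map_comp map_id_in.
Qed.

(** Each entry costs 4|U| + 8 steps, to which rewinding [tY] at the end of a row adds 2(|U| + 1) per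
    row of [tY]; this explains 6|U| + 10. *)
Lemma runs_scan c s st lc lx : uniq s -> oapp isSome false (ohead lx) = false ->
  let st' := edges c st [seq (i, j) | i <- s, j <- enum R] in
  runs scan (tapes lc (rows c s) lx (rows (mem_of st.2.1) s) st.1
               [::] (rows (mem_of st.2.2) (enum R)))
    (size s * (#|R| * (6 * #|U| + 10) + 2 * #|U| + 8)).+1
    (tapes (rev (rows c s) ++ lc) [::] (rev (rows (mem_of st'.2.1) s) ++ lx) [::] st'.1
       [::] (rows (mem_of st'.2.2) (enum R))).
Proof.
elim: s st lc lx => [|i s IHs] st lc lx.
  by move=> _ _; apply: runs_while_stop; rewrite /on zheads_vec4 vec4E.
rewrite cons_uniq => /andP[si us] lx0.
set st1 := edges c st [seq (i, j) | j <- enum R]; move=> st'.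
have def_st' : st' = edges c st1 [seq (i, j) | i <- s, j <- enum R].
  by rewrite /st' /= /edges foldl_cat.
have i1 r : r \in s -> r \notin map fst [seq (i, j) | j <- enum R].
  move=> rs; rewrite -map_comp; apply/mapP => -[j _ /= ri].
  by rewrite -ri rs in si.
have i2 : i \notin map fst [seq (i, j) | i <- s, j <- enum R].
  by apply/mapP => -[e /allpairsP[[k j] [/= ks _ ->]] /= ik]; rewrite ik ks in si.
rewrite !rows_cons.
have -> : rows (mem_of st.2.1) s = rows (mem_of st1.2.1) s.
  by apply: eq_rows => k /i1 ks u; rewrite /mem_of edges_otherl.
have -> : mem_of st'.2.1 i = mem_of st1.2.1 i.
  by rewrite /mem_of def_st' edges_otherl.
apply: (@runs_le _ _ _ (size (enum R) * (4 * #|U| + 8) +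
  ((1 + ((2 * size (bits (mem_of st1.2.1 i) (enum U))).+1 +
         (1 + (2 * size (rows (mem_of st1.2.2) (enum R)) + 3)))).+1 +
    (size s * (#|R| * (6 * #|U| + 10) + 2 * #|U| + 8)).+1).+1)).
  rewrite size_rows size_bits -!cardE [size (_ :: _)]/=.
  by move: (size s) (#|U|) (#|R|) => a k m; nia.
apply: runs_scan_row => //; first exact: enum_uniq.
rewrite -/st1; apply: runs_while; first by rewrite /on zheads_vec4 vec4E.
  apply: runs_if; rewrite /on zheads_vec4 vec4E /=.
  apply: runs_seq; first by apply: runs_mvr; rewrite vec4E.
  rewrite upd_vec4; apply: runs_seq.
    apply: runs_skip; first by rewrite vec4E.
    - by apply/allP => x /mapP[u _ ->].
    - by [].
  rewrite upd_vec4; apply: runs_seq; first by apply: runs_mvr; rewrite vec4E.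
  rewrite upd_vec4; apply: (@runs_rewind _ _ (rows (mem_of st1.2.2) (enum R)) [::]).
  - by rewrite vec4E.
  - exact: all_predT.
  - by [].
rewrite upd_vec4 cats0 def_st'.
have := IHs st1 (None :: rev (bits (c i) (enum R)) ++ lc)
   (None :: rev (bits (mem_of st1.2.1 i) (enum U)) ++ lx) us erefl.
by rewrite !rev_cat !rev_cons !cat_rcons -!catA.
Qed.

Definition flag b : cmd4 := Do (fun _ => vec4 nop nop (Some (cs (Some b)), Stay) nop).

Lemma zact_nop t : zact t nop = t.
Proof. by case: t. Qed.

Lemma runs_flag b tc tx tf ty : tf.1 = [::] -> size tf.2 <= 1 ->
  runs (flag b) (vec4 tc tx tf ty) 1 (vec4 tc tx (wtape [::] [:: Some b]) ty).
Proof.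
move=> f1 f2; apply: runs_do; rewrite zacts_vec4 !zact_nop; congr vec4.
by case: tf f1 f2 => l [|? []] //= ->.
Qed.

Lemma runs_rewind_all k (l s : seq sym) (z : zst) :
  z k = wtape l s ->
  runs (rewind k predT) z (2 * size l + 3) (upd z k (wtape [::] (rev l ++ s))).
Proof.
move=> zk; rewrite -(size_rev l); apply: runs_rewind; rewrite ?all_predT //.
by rewrite revK cats0.
Qed.

Definition pass :=
  Seq (flag false) (Seq (rewind tC predT) (Seq (rewind tX predT) (Seq (rewind tY predT)
  (Seq scan (Seq (rewind tX predT) (Seq (rewind tY predT) sync)))))).

Definition pass_edges c (gf : auth * auth) :=
  edges eq_op (edges c (false, gf) [seq (i, j) | i <- enum R, j <- enum R])
        [seq (r, r) | r <- enum R].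

(** The cost of [scan] dominates; the term 2|R| comes from rewinding [tC], and the other
    coefficients are rounded up. *)
Definition pass_time :=
  #|R| * (#|R| * (6 * #|U| + 10) + 14 * #|U| + 22 + 2 * #|R|) + 20.

(** Only the contents of the tapes matter, not the positions of the heads, so the same statement
    applies after [copy] and after a previous pass. *)
Lemma runs_pass c gf lc sc lx sx fl ly sy :
  rev lc ++ sc = rows c (enum R) ->
  rev lx ++ sx = rows (mem_of gf.1) (enum R) ->
  rev ly ++ sy = rows (mem_of gf.2) (enum R) ->
  let st := pass_edges c gf in
  runs pass (tapes lc sc lx sx fl ly sy) pass_time
    (tapes (rev (rows c (enum R))) [::] (rev (rows (mem_of st.2.1) (enum R))) [::] st.1
       (rev (rows (mem_of st.2.2) (enum R))) [::]).
Proof.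
move=> Ec Ex Ey st; rewrite /st /pass_edges.
set st1 := edges c (false, gf) _; set st2 := edges eq_op st1 _.
have sc_le : size lc <= #|R| * #|R|.+1.
  rewrite {1}cardE -(size_rows c) -Ec size_cat size_rev; exact: leq_addr.
have sx_le : size lx <= #|R| * #|U|.+1.
  rewrite {1}cardE -(size_rows (mem_of gf.1)) -Ex size_cat size_rev; exact: leq_addr.
have sy_le : size ly <= #|R| * #|U|.+1.
  rewrite {1}cardE -(size_rows (mem_of gf.2)) -Ey size_cat size_rev; exact: leq_addr.
apply: (@runs_le _ _ _ (1 + (2 * size lc + 3 + (2 * size lx + 3 + (2 * size ly + 3 +
  ((size (enum R) * (#|R| * (6 * #|U| + 10) + 2 * #|U| + 8)).+1 +
   (2 * size (rev (rows (mem_of st1.2.1) (enum R))) + 3 + (2 * size ([::] : seq sym) + 3 +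
     (size (enum R) * (2 * #|U| + 4)).+1)))))))).
  rewrite size_rev size_rows -!cardE /pass_time.
  move: (size lc) (size lx) (size ly) (#|U|) (#|R|) sc_le sx_le sy_le => a b d k m.
  by rewrite [size _]/=; nia.
apply: runs_seq; first exact: runs_flag.
apply: runs_seq; first by apply: runs_rewind_all; rewrite vec4E.
rewrite upd_vec4 Ec; apply: runs_seq; first by apply: runs_rewind_all; rewrite vec4E.
rewrite upd_vec4 Ex; apply: runs_seq; first by apply: runs_rewind_all; rewrite vec4E.
rewrite upd_vec4 Ey; apply: runs_seq.
  by apply: (@runs_scan c (enum R) (false, gf)); rewrite ?enum_uniq.
rewrite -/st1 !cats0; apply: runs_seq; first by apply: runs_rewind_all; rewrite vec4E.
rewrite upd_vec4 revK cats0; apply: runs_seq; first by apply: runs_rewind_all; rewrite vec4E.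
rewrite upd_vec4.
have := @runs_sync eq_op st1 (enum R) (rev (rows c (enum R))) [::] [::]
  (enum_uniq _) (fun r _ => eqxx r).
by cbv zeta; rewrite !cats0.
Qed.

End Edges.

(** * Copying the input and testing for empty rows *)

Definition copy_cell : cmd4 :=
  Do (fun h => vec4 (Some None, MoveRight) (Some (h tC), MoveRight) nop
                 (Some (h tC), MoveRight)).

(** The outer loop stops at a row that begins with a separator. This is the end of the authorization
    matrix only if its rows are nonempty, whence the hypothesis of [runs_copy]. *)
Definition copy : cmd4 :=
  While (on tC isSome) (Seq (While (on tC isSome) copy_cell) copy_cell).

Definition erase : cmd4 := Do (fun _ => vec4 (Some None, MoveRight) nop nop nop).

Lemma runs_copy_cell x s lx ly tf :
  runs copy_cell (vec4 (wtape [::] (x :: s)) (wtape lx [::]) tf (wtape ly [::])) 1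
    (vec4 (wtape [::] s) (wtape (x :: lx) [::]) tf (wtape (x :: ly) [::])).
Proof.
apply: runs_do; rewrite zheads_vec4 !vec4E zacts_vec4 zact_nop; congr vec4.
by rewrite /zact; case: s.
Qed.

Lemma runs_copy_word w s lx ly tf : all isSome w ->
  runs (While (on tC isSome) copy_cell)
    (vec4 (wtape [::] (w ++ None :: s)) (wtape lx [::]) tf (wtape ly [::])) (2 * size w).+1
    (vec4 (wtape [::] (None :: s)) (wtape (rev w ++ lx) [::]) tf (wtape (rev w ++ ly) [::])).
Proof.
elim: w lx ly => [|x w IHw] lx ly.
  by move=> _; apply: runs_while_stop; rewrite /on zheads_vec4 vec4E.
move=> /= /andP[px pw]; apply: (@runs_le _ _ _ (1 + (2 * size w).+1).+1); first by lia.
apply: runs_while; first by rewrite /on zheads_vec4 vec4E.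
  exact: runs_copy_cell.
by rewrite !rev_cons !cat_rcons; apply: IHw.
Qed.

Lemma all_bits (J : Type) (P : pred J) s : all isSome (bits P s).
Proof. by elim: s. Qed.

Lemma runs_copy (I : Type) (J : finType) (P : I -> pred J) s w lx ly tf :
  (forall i : I, 0 < #|J|) ->
  runs copy (vec4 (wtape [::] (rows P s ++ None :: w)) (wtape lx [::]) tf (wtape ly [::]))
    (size s * (2 * #|J| + 3)).+1
    (vec4 (wtape [::] (None :: w)) (wtape (rev (rows P s) ++ lx) [::]) tf
       (wtape (rev (rows P s) ++ ly) [::])).
Proof.
move=> J_gt0; elim: s lx ly => [|i s IHs] lx ly.
  by apply: runs_while_stop; rewrite /on zheads_vec4 vec4E.
apply: (@runs_le _ _ _ ((2 * size (bits (P i) (enum J))).+1 + 1 +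
   (size s * (2 * #|J| + 3)).+1).+1).
  rewrite size_bits -cardE [size (_ :: _)]/=.
  by move: (size s) (#|J|) => a k; nia.
rewrite rows_cons -catA; apply: runs_while.
- rewrite /on zheads_vec4 vec4E.
  by move: (J_gt0 i); rewrite cardE; case: (enum J).
- apply: runs_seq; first by apply: runs_copy_word; apply: all_bits.
  exact: runs_copy_cell.
- by rewrite rev_cat rev_cons cat_rcons -!catA; apply: IHs.
Qed.

Definition fail_at_sep : cmd4 :=
  Do (fun h => vec4 nop nop (if h tY == cs None then Some (cs (Some false)) else None, Stay) nop).

(** After the leading zeros of a row the head is on a separator exactly when the row is empty as a
    set; then the flag is lowered for good. *)
Definition check : cmd4 :=
  While (on tY predT)
    (Seq (skip tY (pred1 (Some false)))
    (Seq fail_at_sep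
    (Seq (skip tY isSome) (mv tY MoveRight)))).

Lemma bits_split (J : Type) (P : pred J) s : exists k t,
  [/\ bits P s = nseq k (Some false) ++ t, all isSome t &
      ohead t = if has P s then Some (Some true) else None].
Proof.
elim: s => [|j s [k [t [E1 E2 E3]]]]; first by exists 0, [::].
case Pj: (P j); first by exists 0, (bits P (j :: s)); rewrite all_bits /= Pj.
by exists k.+1, t; rewrite /= Pj E1.
Qed.

Lemma runs_check (I : Type) (J : finType) (P : I -> pred J) s lc sc lx sx ly fl :
  runs check (tapes lc sc lx sx fl ly (rows P s)) (size s * (2 * #|J| + 6)).+1
    (tapes lc sc lx sx (fl && all (fun i => has (P i) (enum J)) s) (rev (rows P s) ++ ly) [::]).
Proof.
elim: s ly fl => [|i s IHs] ly fl.
  by rewrite andbT; apply: runs_while_stop; rewrite /on zheads_vec4 vec4E.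
have [k [t [Ebits t_bits head_t]]] := bits_split (P i) (enum J).
have szJ : size (nseq k (Some false) ++ t) = #|J| by rewrite -Ebits size_bits -cardE.
apply: (@runs_le _ _ _ ((2 * size (nseq k (Some false))).+1 + (1 + ((2 * size t).+1 + 1)) +
   (size s * (2 * #|J| + 6)).+1).+1).
  move: szJ; rewrite size_cat [size (_ :: _)]/=.
  by move: (size s) (#|J|) (size t) (size _) => a m b d; nia.
rewrite rows_cons; apply: runs_while.
- by rewrite /on zheads_vec4 vec4E; case: (bits _ _).
- rewrite Ebits -catA; apply: runs_seq.
    apply: runs_skip; first by rewrite vec4E.
      by apply/allP => x /nseqP[->].
    by case: t {Ebits t_bits szJ} head_t => [|x t] //=; case: (has _ _) => // -[->].
  rewrite upd_vec4; apply: runs_seq.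
    apply: runs_do; rewrite zheads_vec4 zacts_vec4 !vec4E !zact_nop.
    set F := zact _ _; have -> : F = wtape [::] [:: Some (fl && has (P i) (enum J))].
      rewrite /F; case: t {Ebits t_bits szJ F} head_t => [|x t] /=.
        by case: has => // _; rewrite andbF.
      by case: has => // -[->]; rewrite andbT.
    reflexivity.
  apply: runs_seq; first by apply: runs_skip; rewrite ?vec4E.
  by rewrite upd_vec4; apply: runs_mvr; rewrite vec4E.
rewrite upd_vec4 -/(tapes _ _ _ _ _ _ _).
have := IHs (None :: rev t ++ rev (nseq k (Some false)) ++ ly) (fl && has (P i) (enum J)).
by rewrite rev_cat rev_cons cat_rcons catA -rev_cat -Ebits /= andbA -!catA.
Qed.

(** * Termination and maximality of the fixpoint iteration *)

Section Refinement.

Variables R U : finType.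
Local Notation auth := {ffun R -> {set U}}.
Implicit Types (c : rel R) (st : bool * (auth * auth)) (e : R * R) (s : seq (R * R)).

(** The potential that bounds the number of passes; it does not depend on the flag. *)
Definition weight st := \sum_r #|st.2.1 r| + \sum_r #|st.2.2 r|.

Lemma sum_fupd (f : auth) r A :
  \sum_i #|fupd f r A i| + #|f r| = \sum_i #|f i| + #|A|.
Proof.
rewrite (bigD1 r) //= [\sum_i #|f i|](bigD1 r) //= ffunE eqxx.
rewrite (eq_bigr (fun i => #|f i|)) => [|i /negPf ir]; last by rewrite ffunE ir.
by rewrite addnC [#|A| + _]addnC addnA.
Qed.

Lemma weight_edge_step c st e :
  weight (edge_step c st e) + ((edge_step c st e).1 && ~~ st.1) <= weight st.
Proof.
rewrite /weight /edge_step; case: ifP => _ /=; last by rewrite andbN addn0.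
set g := st.2.1; set f := st.2.2; set A := _ :&: _.
have := sum_fupd g e.1 A; have := sum_fupd f e.2 A.
have sg : A \subset g e.1 by apply: subsetIl.
have sf : A \subset f e.2 by apply: subsetIr.
have := subset_leqif_cards sg; have := subset_leqif_cards sf.
(* Two different sets cannot both equal their intersection, so at least one of the two rows loses an
   entry. *)
have : (g e.1 != f e.2) -> (A != g e.1) || (A != f e.2).
  by rewrite -negb_and; apply: contraNN => /andP[/eqP {1}<- /eqP <-].
move=> ne [lef eqf] [leg eqg]; rewrite -eqf -eqg in ne.
case: (g e.1 != f e.2) ne; case: (st.1) => /=; do ?[move=> /(_ isT)]; lia.
Qed.

Lemma weight_edges c st s : weight (edges c st s) + ((edges c st s).1 && ~~ st.1) <= weight st.
Proof.
elim: s st => [|e s IHs] st /=; first by rewrite andbN addn0.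
have := IHs (edge_step c st e); have := weight_edge_step c st e.
by case: (edges _ _ _).1; case: (edge_step _ _ _).1; case: st.1 => /=; lia.
Qed.

Definition bounds (h : R -> {set U}) st :=
  forall r, (h r \subset st.2.1 r) && (h r \subset st.2.2 r).

(** If [h] takes the same value at both ends of an edge, that value lies in both rows and hence in
    their intersection. With [h] the rows of a valid relation, this gives maximality. *)
Lemma bounds_edges (h : R -> {set U}) c st s :
  (forall i j, c i j -> h i = h j) -> bounds h st -> bounds h (edges c st s).
Proof.
move=> hc; elim: s st => //= e s IHs st hst; apply: IHs => r.
rewrite /edge_step; case: ifP => //= /hc he; rewrite !ffunE.
have /andP[h1 _] := hst e.1; have /andP[_ h2] := hst e.2.
have /andP[h3 h4] := hst r.
apply/andP; split; case: eqP => // ->; rewrite subsetI.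
  by rewrite h1 he h2.
by rewrite h2 -he h1.
Qed.

Definition below st st' :=
  forall r, (st'.2.1 r \subset st.2.1 r) && (st'.2.2 r \subset st.2.2 r).

Lemma edges_below c st s : below st (edges c st s).
Proof.
elim: s st => [|e s IHs] st r /=; first by rewrite !subxx.
have /andP[h1 h2] := IHs (edge_step c st e) r.
move: (h1) (h2) => /subset_trans-> /=; last first.
  by rewrite /edge_step; case: ifP => //= _; rewrite ffunE; case: eqP => // ->; apply: subsetIl.
move=> /subset_trans-> //.
by rewrite /edge_step; case: ifP => //= _; rewrite ffunE; case: eqP => // ->; apply: subsetIr.
Qed.

(** The flag is never lowered by an edge step, so if it is down at the end, every step met equal
    rows and left the state unchanged; all equations therefore hold in one and the same state. *)
Lemma edges_unflagged c st s : ~~ (edges c st s).1 ->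
  edges c st s = st /\ {in s, forall e, c e.1 e.2 -> st.2.1 e.1 = st.2.2 e.2}.
Proof.
elim: s st => [|e s IHs] st //= fl.
have [E he] := IHs _ fl; rewrite E in fl *.
suff [E1 ce] : edge_step c st e = st /\ (c e.1 e.2 -> st.2.1 e.1 = st.2.2 e.2).
  by rewrite E1 in he *; split=> // e'; rewrite inE => /predU1P[-> //|/he].
case: st fl {E he IHs} => [b [g f]]; rewrite /edge_step /=; case: (c _ _) => //=.
rewrite negb_or negbK => /andP[/negPf-> /eqP gf]; split=> //.
rewrite gf eqxx setIid; congr (_, (_, _)); apply/ffunP => r; rewrite ffunE;
  by case: eqP => // ->.
Qed.

Implicit Types (gf : auth * auth).

Lemma pass_edges_weight c gf :
  weight (pass_edges c gf) + (pass_edges c gf).1 <= weight (true, gf).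
Proof.
rewrite /pass_edges; set st1 := edges c _ _; set st2 := edges _ st1 _.
have := weight_edges c (false, gf) [seq (i, j) | i <- enum R, j <- enum R].
have := weight_edges eq_op st1 [seq (r, r) | r <- enum R].
rewrite -/st1 -/st2 (_ : weight (false, gf) = weight (true, gf)) //.
by case: st1.1; case: st2.1 => /=; lia.
Qed.

Lemma pass_edges_fixpoint c gf : ~~ (pass_edges c gf).1 ->
  [/\ (pass_edges c gf).2 = gf, gf.1 = gf.2 & forall i j, c i j -> gf.1 i = gf.2 j].
Proof.
rewrite /pass_edges => fl.
have [E1 diag] := edges_unflagged fl; rewrite E1 in fl *.
have [E2 cons] := edges_unflagged fl; rewrite E2 in diag *.
split=> // [|i j cij].
  apply/ffunP => r; apply: (diag (r, r)) => //=.
  by apply/mapP; exists r; rewrite ?mem_enum.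
by apply: (cons (i, j)) => //; apply: allpairs_f; rewrite mem_enum.
Qed.

Definition loop := While (on tF (pred1 (Some true))) pass.

(** Induction on a bound [k] for the weight: at most [k] passes raise the flag and one more confirms
    the fixpoint, which gives the factor [k.+1]; each pass is charged one test, and the last test is
    added. *)
Lemma runs_loop c k gf lc sc lx sx ly sy :
  weight (true, gf) <= k ->
  rev lc ++ sc = rows c (enum R) ->
  rev lx ++ sx = rows (mem_of gf.1) (enum R) ->
  rev ly ++ sy = rows (mem_of gf.2) (enum R) ->
  exists f : auth,
    [/\ forall r, f r \subset gf.1 r,
        forall h, (forall i j, c i j -> h i = h j) -> bounds h (true, gf) ->
          forall r, h r \subset f r,
        forall i j, c i j -> f i = f j &
        runs loop (tapes lc sc lx sx true ly sy) (k.+1 * (pass_time R U).+1).+1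
          (tapes (rev (rows c (enum R))) [::] (rev (rows (mem_of f) (enum R))) [::] false
             (rev (rows (mem_of f) (enum R))) [::])].
Proof.
elim: k gf lc sc lx sx ly sy => [|k IHk] gf lc sc lx sx ly sy wk Ec Ex Ey.
all: have runs1 := runs_pass true Ec Ex Ey.
all: have := pass_edges_weight c gf; have := @pass_edges_fixpoint c gf.
all: have on_true a b d l1 l2 l3 l4 : on tF (pred1 (Some true))
       (zheads (tapes a b d l1 l2 l3 l4)) = l2 by rewrite /on zheads_vec4 vec4E; case: l2.
(* Four goals result: for weight bound 0 and then for [k.+1], first the flag raised and then not.
   The first is impossible, as the weight would have to drop below 0. *)
all: case fl: (pass_edges c gf).1.
all: move=> fix_gf dec.
- by move: wk dec; lia.
- have [E1 E2 cons] := fix_gf isT; exists gf.1; split=> //.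
  + by move=> h _ hgf r; have /andP[] := hgf r.
  + by move=> i j /cons; rewrite E2.
  rewrite mul1n; apply: (@runs_le _ _ _ (pass_time R U + 1).+1); first by lia.
  apply: runs_while; first by rewrite on_true.
    exact: runs1.
  rewrite fl E1 -E2; apply: runs_while_stop; by rewrite on_true.
- have {}dec : weight (true, (pass_edges c gf).2) <= k by move: wk dec; rewrite /weight /=; lia.
  have [|||f [sf hf cf runsf]] := IHk (pass_edges c gf).2
    (rev (rows c (enum R))) [::] (rev (rows (mem_of (pass_edges c gf).2.1) (enum R))) [::]
    (rev (rows (mem_of (pass_edges c gf).2.2) (enum R))) [::] dec; rewrite ?revK ?cats0 //.
  exists f; split=> //.
  + move=> r; apply: subset_trans (sf r) _.
    have /andP[h1 _] := edges_below eq_op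
        (edges c (false, gf) [seq (i, j) | i <- enum R, j <- enum R])
        [seq (r, r) | r <- enum R] r.
    have /andP[h2 _] := edges_below c (false, gf) [seq (i, j) | i <- enum R, j <- enum R] r.
    exact: subset_trans h1 h2.
  + move=> h hc hgf; apply: hf => //.
    suff: bounds h (pass_edges c gf) by [].
    by apply: bounds_edges => [i j /eqP->|] //; apply: bounds_edges.
  apply: (@runs_le _ _ _ (pass_time R U + (k.+1 * (pass_time R U).+1).+1).+1); first by lia.
  apply: runs_while; first by rewrite on_true.
    exact: runs1.
  by rewrite fl.
- have [E1 E2 cons] := fix_gf isT; exists gf.1; split=> //.
  + by move=> h _ hgf r; have /andP[] := hgf r.
  + by move=> i j /cons; rewrite E2.
  apply: (@runs_le _ _ _ (pass_time R U + 1).+1); first by lia.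
  apply: runs_while; first by rewrite on_true.
    exact: runs1.
  rewrite fl E1 -E2; apply: runs_while_stop; by rewrite on_true.
Qed.

End Refinement.

(** * The complete program, its running time and its correctness *)

(* The answer bit goes to the blank cell to the left of the matrix on [tY]; if it
   is [false], a blank written after it cuts the matrix off from the output. *)
Definition write_answer : cmd4 :=
  Do (fun h => vec4 nop nop nop
    (Some (h tF), if h tF == cs (Some true) then Stay else MoveRight)).

Definition clear_next : cmd4 :=
  Do (fun h => vec4 nop nop nop
    (if h tF == cs (Some true) then nop else (Some None, MoveLeft))).

Definition solver : cmd4 :=
  Seq copy (Seq erase (Seq (flag true) (Seq loop (Seq (flag true)
  (Seq (rewind tY predT) (Seq check (Seq (rewind tY predT)
  (Seq (mv tY MoveLeft) (Seq write_answer clear_next))))))))).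

Definition instance_size (R U : finType) := #|R| * #|U|.+1 + (#|R| * #|R|.+1).+1.

Lemma solver_time r u :
  (r * (2 * u + 3)).+1 + (1 + (1 +
  (((2 * (r * u)).+1 * (r * (r * (6 * u + 10) + 14 * u + 22 + 2 * r) + 20).+1).+1 + (1 +
  (2 * (r * u.+1) + 3 + ((r * (2 * u + 6)).+1 +
  (2 * (r * u.+1) + 3 + (1 + (1 + 1)))))))))
  <= 300 * (r * u.+1 + (r * r.+1).+1) ^ 3.
Proof.
set L := r * u.+1 + (r * r.+1).+1.
have LE : L = r * u + r * r + 2 * r + 1 by rewrite /L !mulnS; lia.
have L_gt0 : 0 < L by lia.
have rL : r <= L by lia.
have ruL : r * u <= L by lia.
have rrL : r * r <= L by lia.
clearbody L.
(* Each of [r], [r * u], [r * r] and 1 is at most [L], and 74 = 6 + 12 + 14 + 22 + 20. *)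
have pass_le : r * (r * (6 * u + 10) + 14 * u + 22 + 2 * r) + 20 <= 74 * L ^ 2.
  have ->: r * (r * (6 * u + 10) + 14 * u + 22 + 2 * r) =
     6 * (r * (r * u)) + 12 * (r * r) + 14 * (r * u) + 22 * r by lia.
  have := leq_mul rL ruL; have : L <= L * L by rewrite leq_pmulr.
  rewrite expnS expn1; lia.
have loop_le : (2 * (r * u)).+1 * (r * (r * (6 * u + 10) + 14 * u + 22 + 2 * r) + 20).+1
    <= 3 * L * (75 * L ^ 2).
  have L2 : 0 < L ^ 2 by rewrite expn_gt0 L_gt0.
  by apply: leq_mul; [lia | apply: leq_ltn_trans pass_le _; lia].
(* The loop takes 225 of the 300 units of [L ^ 3]; the other phases are linear in [L] and fit into
   the remaining 75. *)
have L3 : L <= L ^ 3 by rewrite expnS leq_pmulr // expn_gt0 L_gt0.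
move: loop_le; have -> : 3 * L * (75 * L ^ 2) = 225 * L ^ 3 by rewrite [L ^ 3]expnS; lia.
set a := (2 * (r * u)).+1 * _; clearbody a; move: (L ^ 3) L3 => k; lia.
Qed.

Lemma runs_solver (R U : finType) (c : rel R) (f0 : {ffun R -> {set U}}) :
  (R -> 0 < #|U|) ->
  exists f : {ffun R -> {set U}},
    [/\ forall r, f r \subset f0 r,
        forall h : R -> {set U}, (forall i j, c i j -> h i = h j) -> (forall r, h r \subset f0 r) ->
          forall r, h r \subset f r,
        forall i j, c i j -> f i = f j &
        let ok := [forall r, f r != set0] in
        exists s z, z.2 = [seq cs x | x <- Some ok :: if ok then rows (mem_of f) (enum R) else [::]]
            ++ pcons None s /\
          exists tc tx tf,
          runs solver (vec4 (wtape [::] (rows (mem_of f0) (enum R) ++ None :: rows c (enum R)))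
             (wtape [::] [::]) (wtape [::] [::]) (wtape [::] [::]))
             (300 * instance_size R U ^ 3) (vec4 tc tx tf z)].
Proof.
move=> U_gt0; set B := rows (mem_of f0) (enum R); set Cw := rows c (enum R).
(* Both copies start with at most |R||U| entries, which gives the weight bound. After [copy], [tX]
   and [tY] have their heads at the right end. *)
have [||||f [sf hf cf runsf]] := @runs_loop R U c (2 * (#|R| * #|U|)) (f0, f0)
  [::] Cw (rev B) [::] (rev B) [::]; rewrite ?revK ?cats0 //.
  rewrite /weight mul2n -addnn; apply: leq_add; rewrite -sum_nat_const;
    apply: leq_sum => r _; exact: max_card.
exists f; split=> //.
  by move=> h hc h0; apply: hf => // r; rewrite /= h0.
move=> ok; set F := rows (mem_of f) (enum R).
have ok_def : ok = all (fun r => has (mem_of f r) (enum U)) (enum R).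
  apply/forallP/allP => [f_ne r _|f_ne r].
    by have /set0Pn[u fu] := f_ne r; apply/hasP; exists u; rewrite ?mem_enum.
  have rR : r \in enum R by rewrite mem_enum.
  by have /hasP[u _ fu] := f_ne r rR; apply/set0Pn; exists u.
(* These are the contents of [tY] after the move onto the blank cell left of the matrix, after
   [write_answer], and after [clear_next], which brings the head back to the answer bit. *)
pose z1 : zt := ([::], pcons None (map cs F)).
pose z2 : zt := if ok then ([::], cs (Some true) :: map cs F)
                else ([:: cs (Some false)], map cs F).
pose z3 : zt := if ok then z2 else ([::], cs (Some false) :: pcons None (behead (map cs F))).
exists (if ok then [::] else behead (map cs F)), z3; split.
  by rewrite /z3 /z2; case: (ok) => /=; rewrite ?cats0.
exists (wtape (rev Cw) [::]), (wtape (rev F) [::]), (wtape [::] [:: Some ok]).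
apply: (@runs_le _ _ _ ((size (enum R) * (2 * #|U| + 3)).+1 + (1 + (1 +
  (((2 * (#|R| * #|U|)).+1 * (pass_time R U).+1).+1 + (1 +
  (2 * size (rev F) + 3 + ((size (enum R) * (2 * #|U| + 6)).+1 +
  (2 * size (rev F) + 3 + (1 + (1 + 1))))))))))).
  rewrite size_rev size_rows -!cardE /instance_size /pass_time.
  exact: solver_time.
apply: runs_seq; first exact: runs_copy.
rewrite cats0; apply: runs_seq; first by apply: runs_do; rewrite zacts_vec4 !zact_nop.
rewrite [zact _ _](_ : _ = wtape [::] Cw); last by rewrite /zact /=; case: (Cw).
apply: runs_seq; first exact: runs_flag.
apply: runs_seq; first exact: runsf.
rewrite -/F -/Cw; apply: runs_seq; first exact: runs_flag.
apply: runs_seq; first by apply: runs_rewind_all; rewrite vec4E.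
rewrite upd_vec4 revK cats0; apply: runs_seq; first exact: runs_check.
rewrite -ok_def cats0 -/F; apply: runs_seq; first by apply: runs_rewind_all; rewrite vec4E.
rewrite upd_vec4 revK cats0; apply: runs_seq; first exact: runs_mv.
rewrite vec4E upd_vec4 [zmove _ _](_ : _ = z1) //.
apply: (@runs_seq _ _ _ _ _ _
  (vec4 (wtape (rev Cw) [::]) (wtape (rev F) [::]) (wtape [::] [:: Some ok]) z2)).
  apply: runs_do; rewrite zheads_vec4 !vec4E zacts_vec4 !zact_nop; congr vec4.
  by rewrite /z1 /z2 /zact /=; case: (ok); case: (F).
apply: runs_do; rewrite zheads_vec4 !vec4E zacts_vec4 !zact_nop; congr vec4.
by rewrite /z3 /z2; case: (ok).
Qed.

Theorem theorem7 :
  @poly_time_solvable (option bool : finType) bodu_instance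
    (fun x => option (relation_of x))
    enc_instance enc_answer correct_answer.
Proof.
exists (machine solver), (300%N *: 'X^3)%R => x.
pose U := users x; pose R := resources x.
pose c : rel R := fun i j => (i, j) \in constraints x.
pose f0 : {ffun R -> {set U}} := [ffun r => users_of (base_auth x) r].
have U_gt0 : R -> 0 < #|U|.
  by move=> r; have /set0Pn[u _] := @base_auth_complete x r; apply/card_gt0P; exists u.
have [f [sf hf cf [s [z [zE [tc [tx [tf [m mb E]]]]]]]]] := runs_solver c f0 U_gt0.
have in_enc : enc_instance x = rows (mem_of f0) (enum R) ++ None :: rows c (enum R).
  rewrite /enc_instance /enc_relation !enc_matrixE; congr (_ ++ _).
  by apply: eq_rows => r _ u; rewrite /mem_of ffunE inE.
have in_size : size (enc_instance x) = instance_size R U.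
  by rewrite in_enc size_cat /= !size_rows -!cardE.
set ok := [forall r, f r != set0] in zE.
pose A : relation_of x := [set p | p.1 \in f p.2].
have usersA r : users_of A r = f r by apply/setP => u; rewrite !inE.
exists (if ok then Some A else None).
  case: ifPn => /= [/forallP f_ne|/forallPn[r]].
    split=> [|r|[i j] /cf fij]; rewrite /sat_bodu ?usersA //.
    apply/subsetP => -[u r]; rewrite inE /= => fu.
    by have := subsetP (sf r) u fu; rewrite ffunE inE.
  rewrite negbK => /eqP fr0 [A' [A'B A'_ne A'c]].
  have := A'_ne r; rewrite -subset0 -fr0 => /negP; apply.
  (* The rows of the supposed valid relation [A'] are below [f] by maximality, so [A'] would have an
     empty row at [r]. *)
  apply: (hf (users_of A')) => [i j cij|k]; first exact: (A'c (i, j)).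
  by rewrite ffunE; apply/subsetP => u; rewrite !inE; apply: (subsetP A'B).
rewrite in_size hornerZ hornerXn.
apply: (@machine_computes _ _ _ _ _ _ m _ (vec4 tc tx tf z) s); last 2 first.
- exact: mb.
- have -> : ord_max = tY by apply: val_inj.
  rewrite vec4E zE; congr (_ ++ _); case: (ok) => //=; congr (_ :: _); congr map.
  by rewrite /enc_relation enc_matrixE; apply: eq_rows => r _ u; rewrite inE.
rewrite in_enc; congr exec: E.
by apply/esym/eq_vec4; rewrite ffunE.
Qed.
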